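(* Let $G$ be a simple graph. Then $G\in\mathcal{G}^*$ if and only if every block $B$ of $G$ satisfies one of the following: (i) $B$ is bipartite; or (ii) $B\cong K_4$; or (iii) $B\cong \Theta_{1,p_1,\ldots,p_r}$ for some $r\ge 1$ and some even positive integers $p_1,\ldots,p_r$.
   Context: All graphs are simple. $\mathcal{G}^*$ denotes the class of graphs $G$ such that any two distinct odd cycles $C_1,C_2$ of $G$ satisfy $|E(C_1)\cap E(C_2)|\le 1$. A block of a graph is a maximal $2$-connected subgraph. For positive integers $p_1,\ldots,p_k$, the $\Theta$-graph $\Theta_{p_1,\ldots,p_k}$ is the graph obtained from two vertices $x_1,x_2$ joined by $k$ internally disjoint paths, the $i$th path having $p_i$ edges. If $p_i=1$, the $i$th path is the single edge $x_1x_2$. *)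

(* Defs.v *)
(* A finite simple graph is a symmetric irreflexive
   relation e : rel T on a finType T. *)
From mathcomp Require Import all_boot.
Set Implicit Arguments. Unset Strict Implicit. Unset Printing Implicit Defensive.

Section GraphDefs.
Variable T : finType.
Variable e : rel T.

Definition cedges (c : seq T) : {set {set T}} :=
  [set [set x; next c x] | x in c].

Definition is_cycle (c : seq T) : bool := (2 < size c) && ucycleb e c.

Definition is_odd_cycle (c : seq T) : bool := is_cycle c && odd (size c).

(* The class G^* : two distinct odd cycles (cycles = subgraphs, identified
   by their edge sets) share at most one edge. *)
Definition inGstar : Prop :=
  forall c1 c2 : seq T, is_odd_cycle c1 -> is_odd_cycle c2 ->
    cedges c1 != cedges c2 -> #|cedges c1 :&: cedges c2| <= 1.

Definition induced (S : {set T}) : rel T :=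
  fun x y => [&& x \in S, y \in S & e x y].

Definition connected_on (S : {set T}) : Prop :=
  forall x y, x \in S -> y \in S -> connect (induced S) x y.

Definition two_connected_on (S : {set T}) : Prop :=
  2 < #|S| /\ connected_on S /\ forall v, v \in S -> connected_on (S :\ v).

(* A block: a maximal 2-connected (hence induced) subgraph, given by its
   vertex set. *)
Definition is_block (S : {set T}) : Prop :=
  two_connected_on S /\
  forall S' : {set T}, S \proper S' -> ~ two_connected_on S'.

Definition bipartite_on (S : {set T}) : Prop :=
  exists f : T -> bool, forall x y, x \in S -> y \in S -> e x y -> f x != f y.

Definition K4_on (S : {set T}) : Prop :=
  #|S| = 4 /\ forall x y, x \in S -> y \in S -> x != y -> e x y.

Definition iso_on (S : {set T}) (U : finType) (eU : rel U) : Prop :=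
  exists f : T -> U,
    [/\ {in S &, injective f}, f @: S = [set: U] &
        forall x y, x \in S -> y \in S -> e x y = eU (f x) (f y)].
End GraphDefs.
Arguments iso_on {T} e S U eU.

(* Theta graph Theta_{p_1,...,p_k} for ps = [:: p_1; ...; p_k] (all p_i >= 1).
   Vertices: inl false = x1, inl true = x2, and inr (i, j) = the (j+1)-th
   internal vertex of the i-th path (0 <= j < p_i - 1). *)
Definition theta_vertex (ps : seq nat) : finType :=
  (bool + {i : 'I_(size ps) & 'I_(nth 0 ps i).-1})%type.

Definition theta_pos (ps : seq nat) (v : theta_vertex ps) (i : 'I_(size ps))
  : option nat :=
  match v with
  | inl false => Some 0
  | inl true => Some (nth 0 ps i)
  | inr (existT k j) => if k == i then Some (val j).+1 else None
  end.

Definition theta_rel (ps : seq nat) : rel (theta_vertex ps) :=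
  fun u v => [exists i : 'I_(size ps),
    match theta_pos u i, theta_pos v i with
    | Some a, Some b => (a.+1 == b) || (b.+1 == a)
    | _, _ => false
    end].
Arguments theta_rel ps : clear implicits.
Arguments theta_pos ps v i : clear implicits.

(* Main.v *)
Require Import Defs.
From mathcomp Require Import all_boot zify.
Set Implicit Arguments. Unset Strict Implicit. Unset Printing Implicit Defensive.

(* If three internally disjoint u-v paths are such that the length of the first
   has the other parity than the two remaining ones, then the first closes an odd
   cycle with each of the others, so in G^* it is a single edge; the other two
   then have even length. This is the only way in which membership in G^* is used.

   A 2-connected non-bipartite B contains an odd cycle, hence a fan: an edge xy
   together with disjoint x-y paths of even length. Any further ear of a fan
   either produces a larger fan (possibly on another edge uv) or joins inner
   points of two different paths; in the latter case both paths have length 2, the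
   ear is an edge, and there is a K4, which in G^* admits no ear. So B is K4 or a
   largest fan covers all vertices and edges of B.

   Conversely two odd cycles with two common edges lie in one block, since the
   union of their vertex sets is 2-connected. In a theta graph with one edge and
   even paths, colouring by the parity of the position shows that every odd cycle
   uses the edge x1x2; as inner vertices have degree 2, it consists of this edge
   and of one path. *)

(** * Duplicate-freeness and parity by arithmetic *)

Lemma uniq_count_leq (T : eqType) (s1 s2 : seq T) :
  (forall z, count_mem z s1 <= count_mem z s2) -> uniq s2 -> uniq s1.
Proof.
move=> le12 Us2; apply: count_mem_uniq => z.
have := le12 z; rewrite (count_uniq_mem z Us2) -[z \in s1]has_pred1 has_count.
by case: (z \in s2); case: (count_mem z s1) => [|[|n]].
Qed.

Ltac goal_lia := repeat (match goal with H : is_true _ |- _ => clear H end); lia.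
(** Disjointness of paths is recorded as [uniq] of one concatenation. For a rearranged part of it,
    [uniq_by] compares multiplicities: counts add up along concatenation and ignore reversal, so a
    linear inequality remains. *)
Ltac count_lia :=
  rewrite /= -?cats1 /= ?(count_cat, count_rev) /= ?(count_cat, count_rev) /=;
  repeat (match goal with |- context [nat_of_bool ?b] => generalize (nat_of_bool b); intro end);
  goal_lia.
Ltac uniq_by H := apply: (uniq_count_leq _ H) => ?; count_lia.

Ltac odd_cases :=
  rewrite /= -?cats1 ?(size_cat, size_rev, addnS, addn0, oddD) /= ?negbK;
  repeat (match goal with |- context [odd ?n] => case: (odd n) => //= end).

(** * Cycles and theta subgraphs *)

Section Cycles.
Variables (T : finType) (e : rel T).
Hypotheses (e_sym : symmetric e) (e_irr : irreflexive e).

(** Throughout, a path from [u] to [v] is given by the list [A] of its inner vertices: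
    [odd (size A)] means even length, and [A = [::]] a single edge. *)
Lemma path_rev_rcons u A v : path e u (rcons A v) = path e v (rcons (rev A) u).
Proof.
rewrite -[in RHS](last_rcons u A v) -rev_cons -(belast_rcons u A v) rev_path.
exact: eq_path.
Qed.

Lemma cycle_cat2 u A v B :
  cycle e (u :: A ++ v :: B) = path e u (rcons A v) && path e v (rcons B u).
Proof. by rewrite /= rcons_cat /= cat_path rcons_path /= -andbA. Qed.

Lemma cedges_mem (c : seq T) E z : E \in cedges c -> z \in E -> z \in c.
Proof.
by case/imsetP=> x xc ->; rewrite !inE => /orP[]/eqP->; rewrite ?mem_next.
Qed.

Lemma cedges_next (c : seq T) x : x \in c -> [set x; next c x] \in cedges c.
Proof. by move=> xc; apply/imsetP; exists x. Qed.

Lemma is_odd_cycleE c : uniq c -> 2 < size c -> cycle e c -> odd (size c) ->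
  is_odd_cycle e c.
Proof. by rewrite /is_odd_cycle /is_cycle /ucycleb => -> -> -> ->. Qed.

Lemma shared_edges_le1 (E F : {set T}) (X Y : {set {set T}}) :
  #|X :&: Y| <= 1 -> E \in X -> E \in Y -> F \in X -> F \in Y -> E = F.
Proof.
move=> le1 EX EY FX FY; move/card_le1_eqP: le1; apply; exact/setIP.
Qed.

Section Gstar.
Hypothesis eG : inGstar e.

(** If [A] had an inner vertex, its first two edges would lie on both odd cycles that [A] closes
    with [B] and with [C]. An inner vertex of [B] tells these cycles apart. *)
Lemma theta_arc_nil_aux u v A B C : B != [::] ->
  uniq (u :: v :: A ++ B ++ C) ->
  path e u (rcons A v) -> path e u (rcons B v) -> path e u (rcons C v) ->
  odd (size A) != odd (size B) -> odd (size A) != odd (size C) -> A = [::].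
Proof.
move=> B0 U pA pB pC oB oC; case: A U pA oB oC => // a A U pA oB oC.
pose c D := u :: (a :: A) ++ v :: rev D.
have cE D : uniq (u :: v :: (a :: A) ++ D) -> path e u (rcons D v) ->
    odd (size (a :: A)) != odd (size D) -> is_odd_cycle e (c D).
  move=> UD pD oD; apply: is_odd_cycleE.
  - by uniq_by UD.
  - by rewrite /c /= size_cat /= addnS.
  - by rewrite cycle_cat2 pA -path_rev_rcons.
  - by move: oD; rewrite /c /= size_cat /= size_rev; clear; lia.
have cB : is_odd_cycle e (c B) by apply: cE => //; uniq_by U.
have cC : is_odd_cycle e (c C) by apply: cE => //; uniq_by U.
have [b bB] : exists b, b \in B.
  by case: (B) B0 => // b B' _; exists b; rewrite mem_head.
have bC : b \notin c C.
  have : uniq (c C ++ B) by uniq_by U.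
  by rewrite cat_uniq => /and3P[_ /hasPn/(_ b bB)].
have nBC : cedges (c B) != cedges (c C).
  apply: contra bC => /eqP EBC.
  have bcB : b \in c B by rewrite /c !(inE, mem_cat, mem_rev) bB !orbT.
  by apply: (@cedges_mem _ [set b; next (c B) b]);
     rewrite -?EBC ?cedges_next // set21.
(* Here [A] is what follows [a]; if it is empty, the path goes on from [a] to [v], hence the
   default. *)
pose a2 := head v A.
have uvA : u \notin a :: v :: A.
  have : uniq (u :: a :: v :: A) by uniq_by U.
  by case/andP.
have ua : u != a by apply: contraNneq uvA => ->; exact: mem_head.
have ua2 : u != a2.
  by apply: contraNneq uvA => ->; rewrite /a2 in_cons; case: (A) => [|? ?];
    rewrite !inE eqxx ?orbT.
have ua_in D : [set u; a] \in cedges (c D).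
  have := @cedges_next (c D) u (mem_head _ _).
  by rewrite /c /= eqxx.
have aa_in D : [set a; a2] \in cedges (c D).
  have ac: a \in c D by rewrite /c !inE eqxx orbT.
  have := cedges_next ac; rewrite /c /= eq_sym (negPf ua) /a2.
  by case: (A) => [|? ?] /=; rewrite eqxx.
have := shared_edges_le1 (eG cB cC nBC) (ua_in B) (ua_in C) (aa_in B) (aa_in C).
move/setP/(_ u); rewrite !inE eqxx /= => /esym/orP[]; first by rewrite (negPf ua).
by rewrite (negPf ua2).
Qed.

Lemma theta_arc_nil u v A B C : (B != [::]) || (C != [::]) ->
  uniq (u :: v :: A ++ B ++ C) ->
  path e u (rcons A v) -> path e u (rcons B v) -> path e u (rcons C v) ->
  odd (size A) != odd (size B) -> odd (size A) != odd (size C) -> A = [::].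
Proof.
case/orP=> D0 U pA pB pC oB oC.
  exact: (theta_arc_nil_aux D0 U).
by apply: (theta_arc_nil_aux D0 _ pA pC pB oC oB); uniq_by U.
Qed.

(** The arcs [m] and [O] of an odd cycle differ in parity, and the ear [Q] agrees with one of them;
    the other is then a single edge. The last hypothesis ensures that, whichever arc is exceptional,
    another one has an inner vertex. *)
Lemma odd_cycle_ear u m w O Q :
  cycle e (u :: m ++ w :: O) -> odd (size m + size O) ->
  uniq (u :: m ++ w :: O ++ Q) -> path e u (rcons Q w) ->
  (Q != [::]) || (m != [::]) && (O != [::]) ->
  odd (size Q) /\ (m = [::] \/ O = [::]).
Proof.
rewrite cycle_cat2 (path_rev_rcons w) => /andP[pm pO] odd_mO U pQ nQ.
have revO0 : (rev O != [::]) = (O != [::]) by rewrite -!size_eq0 size_rev.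
have U' : uniq (u :: w :: m ++ rev O ++ Q) by uniq_by U.
have [eqQm|neQm] := eqVneq (odd (size Q)) (odd (size m)).
  have O0 : rev O = [::].
    apply: (@theta_arc_nil u w (rev O) m Q) => //.
    - by case/orP: nQ => [->|/andP[-> _]]; rewrite ?orbT.
    - by uniq_by U.
    - by move: odd_mO; odd_cases.
    - by move: odd_mO; rewrite eqQm; odd_cases.
  have {}O0 : O = [::] by rewrite -(revK O) O0.
  by split; [move: odd_mO; rewrite O0 addn0 -eqQm | right].
have m0 : m = [::].
  apply: (@theta_arc_nil u w m (rev O) Q) => //.
  - by rewrite revO0; case/orP: nQ => [->|/andP[_ ->]]; rewrite ?orbT.
  - by move: odd_mO; odd_cases.
  - by rewrite eq_sym.
by split; [move: neQm; rewrite m0; odd_cases | left].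
Qed.

End Gstar.
End Cycles.

(** * Fans and their ears *)

Section Fans.
Variables (T : finType) (e : rel T).
Hypotheses (e_sym : symmetric e) (e_irr : irreflexive e) (eG : inGstar e).

(** A copy of [Theta_{1,p_1,...,p_r}] inside [B], neither induced nor spanning in general. *)
Definition is_fan (B : {set T}) x y (ps : seq (seq T)) : Prop :=
  [/\ e x y, ps != [::],
      all (fun s => odd (size s) && path e x (rcons s y)) ps,
      uniq (x :: y :: flatten ps) & {subset x :: y :: flatten ps <= B}].

(** The base edge counts as one more path, without inner vertices. Adjacency is read off positions,
    as in [theta_rel]. *)
Definition fan_edge x y (ps : seq (seq T)) p q : bool :=
  has (fun s => let F := x :: rcons s y in
    [&& p \in F, q \in F & ((index p F).+1 == index q F) || ((index q F).+1 == index p F)])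
    ([::] :: ps).

Definition larger_fan B (ps : seq (seq T)) : Prop :=
  exists x y ps', is_fan B x y ps' /\ size (flatten ps) < size (flatten ps').

Lemma fan_perm B x y ps ps' : perm_eq ps ps' -> is_fan B x y ps -> is_fan B x y ps'.
Proof.
move=> eps [exy ps0 aps U sB].
have efl : perm_eq (x :: y :: flatten ps) (x :: y :: flatten ps').
  by rewrite !perm_cons perm_flatten.
split=> //.
- by rewrite -size_eq0 -(perm_size eps) size_eq0.
- by rewrite -(perm_all _ eps).
- by rewrite -(perm_uniq efl).
- by move=> z; rewrite -(perm_mem efl); apply: sB.
Qed.

Lemma larger_fan_perm B ps ps' : perm_eq ps ps' -> larger_fan B ps -> larger_fan B ps'.
Proof.
move=> eps [x [y [qs [fqs lt_qs]]]]; exists x, y, qs; split=> //.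
by rewrite -(perm_size (perm_flatten eps)).
Qed.

(** The path [s] and the edge [xy] form an odd cycle with arcs [m] and [l2 ++ l1] between [u] and
    [w], the latter through the step from [y] to [x]. By [odd_cycle_ear], an edge [uw] cannot leave
    inner vertices on both arcs, so it belongs to the cycle. *)
Lemma ear_same_path B x y s ps l1 u m w l2 Q :
  is_fan B x y (s :: ps) -> x :: rcons s y = l1 ++ u :: m ++ w :: l2 ->
  uniq (x :: y :: flatten (s :: ps) ++ Q) -> {subset Q <= B} ->
  path e u (rcons Q w) ->
  Q = [::] /\ (m = [::] \/ l1 = [::] /\ l2 = [::]) \/ larger_fan B (s :: ps).
Proof.
move=> [exy _ all_s U sB] Fdef UQ QB pQ.
move: all_s; rewrite [all _ _]/= => /andP[/andP[os ps_xy] aps].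
have cF : cycle e (u :: m ++ w :: (l2 ++ l1)).
  have -> : u :: m ++ w :: l2 ++ l1 = rot (size l1) (x :: rcons s y).
    by rewrite Fdef rot_size_cat /= -catA.
  by rewrite rot_cycle /= rcons_path last_rcons ps_xy e_sym.
have szF : size s = size l1 + size m + size l2.
  by have := congr1 size Fdef; rewrite /= size_rcons !size_cat /= size_cat /=; goal_lia.
have oddF : odd (size m + size (l2 ++ l1)).
  by move: os; rewrite szF; odd_cases.
have countF z : count_mem z (x :: rcons s y) = count_mem z (l1 ++ u :: m ++ w :: l2).
  by rewrite Fdef.
have UF : uniq (u :: m ++ w :: l2 ++ l1 ++ flatten ps ++ Q).
  apply: (uniq_count_leq _ UQ) => z; move: (countF z); count_lia.
have [Q0|Q0] := eqVneq Q [::].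
  left; split=> //; have [-> | m0] := eqVneq m [::]; first by left.
  have [O0|O0] := eqVneq (l2 ++ l1) [::].
    by right; case: (l1) (l2) O0 => [|? ?] [|? ?].
  have [||] // := odd_cycle_ear e_sym eG cF oddF _ pQ _.
  - by uniq_by UF.
  - by rewrite m0 O0 orbT.
  - by rewrite Q0.
right.
(* Either the ear spans the whole path s and is a new path of the fan, or u and w
   are consecutive on s: with no other path the cycle and the ear form a fan on the
   edge uw; otherwise replacing xy by another path s' in the arc from w to u gives
   an even cycle through uw, which contradicts theta_arc_nil for the ear. *)
have [||oQ mO] := odd_cycle_ear e_sym eG cF oddF _ pQ _.
- by uniq_by UF.
- by rewrite Q0.
have lt_szQ : 0 < size Q by rewrite lt0n size_eq0.
case: mO => [m0|/eqP O0]; last first.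
  have [l10 l20]: l1 = [::] /\ l2 = [::] by case: (l1) (l2) O0 => [|? ?] [|? ?].
  move: Fdef; rewrite l10 l20 cats1 -rcons_cons => -[xu] /rcons_inj[sm yw].
  exists x, y, (Q :: s :: ps); split; last by rewrite /= [ltnRHS]size_cat -[ltnLHS]add0n ltn_add2r.
  split=> //.
  - by rewrite /= oQ os ps_xy aps xu yw pQ.
  - by uniq_by UQ.
  - by move=> z; rewrite !inE /= mem_cat orbA => /or3P[zxy|/QB //|zs];
      apply: sB; rewrite !inE orbA ?zxy // zs orbT.
move: cF; rewrite m0 (cycle_cat2 _ _ [::]) /= andbT => /andP[euw pO].
case: ps aps U sB UQ countF UF => [|s' ps] aps U sB UQ countF UF.
  exists u, w, [:: Q; rev (l2 ++ l1)]; split; last first.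
    by rewrite /= !cats0 !size_cat size_rev size_cat szF m0 /=; move: lt_szQ; goal_lia.
  split=> //.
  - rewrite /= oQ pQ path_rev_rcons // revK pO size_rev.
    by move: oddF; rewrite m0 add0n => ->.
  - by uniq_by UF.
  - move=> z zin.
    have : 0 < count_mem z (u :: w :: l2 ++ l1 ++ Q).
      rewrite -has_count has_pred1.
      by move: zin; rewrite /= !(inE, mem_cat, mem_rev) orbF; do !case: (_ \in _); rewrite ?orbT.
    rewrite m0 in countF.
    have -> : count_mem z (u :: w :: l2 ++ l1 ++ Q) = count_mem z ((x :: y :: flatten [:: s]) ++ Q).
      by move: (countF z); count_lia.
    by rewrite -has_count has_pred1 mem_cat => /orP[/sB|/QB].
case: notF.
have [os' ps'] : odd (size s') /\ path e x (rcons s' y) by case/andP: aps => /andP[].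
(* [u] may be [x], and [w] may be [y]; [t] and [t'] treat these cases together with the general
   one. *)
have [t xt] : exists t, rcons l1 u = x :: t.
  by case: (l1) Fdef => [|x1 l1'] /= [-> _]; [exists [::] | exists (rcons l1' u)].
have [t' yt] : exists t', w :: l2 = rcons t' y.
  have := congr1 (last x) Fdef; rewrite /= last_rcons last_cat /= last_cat /= => ->.
  by exists (belast w l2); rewrite -lastI.
have pOs : path e w (rcons (l2 ++ rev s' ++ l1) u).
  have : path e x (rcons s y) by [].
  have -> : rcons s y = t ++ w :: l2.
    have : x :: rcons s y = (x :: t) ++ w :: l2 by rewrite Fdef m0 -xt cat_rcons.
    by case.
  rewrite cat_path /= => /and3P[pt _ pl2].
  have ly : last w l2 = y by have := congr1 (last w) yt; rewrite last_rcons.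
  rewrite !rcons_cat cat_path pl2 ly xt -cat_rcons cat_path.
  by rewrite last_rcons -path_rev_rcons // ps' pt.
have odd_rest : ~~ odd (size (l2 ++ rev s' ++ l1)).
  move: os os'; rewrite szF m0; odd_cases.
suff Q0' : Q = [::] by rewrite Q0' in Q0.
apply: (@theta_arc_nil _ _ e_sym eG u w Q [::] (rev (l2 ++ rev s' ++ l1))) => //.
- by rewrite orbC -size_eq0 size_rev !size_cat size_rev; case: (s') os' => //= ? ? _; rewrite addnCA.
- by uniq_by UF.
- by rewrite /= euw.
- by rewrite path_rev_rcons // revK.
- by rewrite /= oQ.
- by rewrite size_rev oQ (negPf odd_rest).
Qed.

(** Following [a] from [x] to [u] and then [Q] gives an ear of the odd cycle formed by [c ++ w :: d]
    and the edge [xy]. One arc of this cycle between [x] and [w] passes through [y], so by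
    [odd_cycle_ear] the other one, [c], is the single edge. *)
Lemma ear_two_paths_nil x y u w a c d Q :
  e x y -> path e x (rcons (c ++ w :: d) y) -> odd (size (c ++ w :: d)) ->
  path e x (rcons a u) -> path e u (rcons Q w) ->
  uniq (x :: y :: u :: w :: a ++ c ++ d ++ Q) ->
  c = [::] /\ odd (size a + size Q).+1.
Proof.
move=> exy ps os pa pQ U.
have cF : cycle e (x :: c ++ w :: rcons d y).
  by rewrite -rcons_cons -rcons_cat /= rcons_path last_rcons ps e_sym.
have pE : path e x (rcons (a ++ u :: Q) w).
  by rewrite rcons_cat rcons_cons -cat_rcons cat_path last_rcons pa.
have [|||] := odd_cycle_ear e_sym eG cF _ _ pE _.
- by move: os; rewrite size_rcons size_cat /=.
- by uniq_by U.
- by case: (a).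
by rewrite size_cat [size (u :: Q)]/= addnS => oQ []// /eqP; rewrite -size_eq0 size_rcons.
Qed.

(** [ear_two_paths_nil] is applied from [x] and from [y], with each of the two paths closing the
    cycle in turn; all four end pieces [a], [b], [c], [d] turn out empty. *)
Lemma ear_two_paths B x y ps a u b c w d Q :
  is_fan B x y ((a ++ u :: b) :: (c ++ w :: d) :: ps) ->
  uniq (x :: y :: flatten ((a ++ u :: b) :: (c ++ w :: d) :: ps) ++ Q) ->
  path e u (rcons Q w) -> K4_on e [set x; y; u; w].
Proof.
move=> [exy _ all_s _ _] UQ pQ.
move: all_s; rewrite [all _ _]/= => /and3P[/andP[os ps1] /andP[os' ps2] _].
have eyx : e y x by rewrite e_sym.
have revc (l1 l2 : seq T) z : rev (l1 ++ z :: l2) = rev l2 ++ z :: rev l1.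
  by rewrite rev_cat rev_cons cat_rcons.
have prefix l1 z l2 (x' y' : T) : path e x' (rcons (l1 ++ z :: l2) y') -> path e x' (rcons l1 z).
  by rewrite rcons_cat rcons_cons -cat_rcons cat_path => /andP[].
have ps1r : path e y (rcons (rev b ++ u :: rev a) x) by rewrite -revc -path_rev_rcons.
have ps2r : path e y (rcons (rev d ++ w :: rev c) x) by rewrite -revc -path_rev_rcons.
have pQr : path e w (rcons (rev Q) u) by rewrite -path_rev_rcons.
have os_r : odd (size (rev b ++ u :: rev a)) by rewrite -revc size_rev.
have os'_r : odd (size (rev d ++ w :: rev c)) by rewrite -revc size_rev.
have [c0 oQ] : c = [::] /\ odd (size a + size Q).+1.
  by apply: (ear_two_paths_nil exy ps2 os' (prefix _ _ _ _ _ ps1) pQ); uniq_by UQ.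
have [a0 _] : a = [::] /\ odd (size c + size (rev Q)).+1.
  by apply: (ear_two_paths_nil exy ps1 os (prefix _ _ _ _ _ ps2) pQr); uniq_by UQ.
have [d0 _] : rev d = [::] /\ odd (size (rev b) + size Q).+1.
  by apply: (ear_two_paths_nil eyx ps2r os'_r (prefix _ _ _ _ _ ps1r) pQ); uniq_by UQ.
have [b0 _] : rev b = [::] /\ odd (size (rev d) + size (rev Q)).+1.
  by apply: (ear_two_paths_nil eyx ps1r os_r (prefix _ _ _ _ _ ps2r) pQr); uniq_by UQ.
have {}UQ : uniq (x :: y :: u :: w :: Q) by uniq_by UQ.
move: ps1 ps2 oQ; rewrite -(revK b) -(revK d) a0 b0 c0 d0 /= !andbT add0n.
move=> /andP[exu euy] /andP[exw ewy] oQ.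
(* The ear has an even number of inner vertices, while the paths from [u] to [w] through [x] and
   through [y] have one each. *)
have Q0 : Q = [::].
  apply: (@theta_arc_nil _ _ e_sym eG u w Q [:: x] [:: y]) => //.
  - by uniq_by UQ.
  - by rewrite /= e_sym exu exw.
  - by rewrite /= euy e_sym ewy.
  - by move: oQ => /=; case: (odd _).
  - by move: oQ => /=; case: (odd _).
have euw : e u w by move: pQ; rewrite Q0 /= andbT.
have U4 : uniq [:: x; y; u; w] by uniq_by UQ.
have mem4 z : (z \in [set x; y; u; w]) = (z \in [:: x; y; u; w]) by rewrite !inE -!orbA.
split; first by rewrite (eq_card mem4) (card_uniqP U4).
move=> p q; rewrite !mem4 !inE.
by do 2![case/or4P => /eqP->]; rewrite ?eqxx // => _ //; rewrite e_sym.
Qed.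

Lemma split_two (s : seq T) p q : p \in s -> q \in s -> p != q ->
  exists l1 m l2, s = l1 ++ p :: m ++ q :: l2 \/ s = l1 ++ q :: m ++ p :: l2.
Proof.
move=> ps qs npq; case/splitPr: ps qs => l1 l2.
rewrite mem_cat inE eq_sym (negPf npq) /= => /orP[].
  by case/splitPr=> l3 l4; exists l3, l4, l2; right; rewrite -catA.
by case/splitPr=> l3 l4; exists l1, l3, l4; left.
Qed.

(** The ends [x] and [y] belong to every path, so two points fail to share a path only if they are
    inner points of different ones. The permutation brings the paths concerned to the front, where
    the ear lemmas expect them. *)
Lemma fan_two_points (x y : T) (ps : seq (seq T)) p q : ps != [::] ->
  p \in x :: y :: flatten ps -> q \in x :: y :: flatten ps ->
  (exists s ps', [/\ perm_eq ps (s :: ps'), p \in x :: rcons s y & q \in x :: rcons s y]) \/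
  (exists s s' ps', [/\ perm_eq ps (s :: s' :: ps'), p \in s & q \in s']).
Proof.
move=> ps0 pin qin.
have on_path z : z \in x :: y :: flatten ps ->
    (forall s, z \in x :: rcons s y) \/ (exists2 s, s \in ps & z \in s).
  rewrite !inE orbA => /orP[zxy|/flattenP[s]]; last by right; exists s.
  by left=> s; rewrite inE mem_rcons inE orbA zxy.
have sub s z : z \in s -> z \in x :: rcons s y.
  by rewrite inE mem_rcons inE => ->; rewrite !orbT.
have [p_all|[s sps ps_]] := on_path p pin; last first.
  have [q_all|[s' s'ps qs']] := on_path q qin.
    by left; exists s, (rem s ps); split; [exact: perm_to_rem | exact: sub | exact: q_all].
  have [ss'|nss'] := eqVneq s s'.
    by left; exists s, (rem s ps); split; [exact: perm_to_rem | exact: sub | apply: sub; rewrite ss'].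
  right; exists s, s', (rem s' (rem s ps)); split=> //.
  apply: perm_trans (perm_to_rem sps) _; rewrite perm_cons; apply: perm_to_rem.
  by have := s'ps; rewrite (perm_mem (perm_to_rem sps)) inE eq_sym (negPf nss').
have [q_all|[s' s'ps qs']] := on_path q qin.
  case: ps ps0 {pin qin on_path} => // s ps _.
  by left; exists s, ps; split.
by left; exists s', (rem s' ps); split; [exact: perm_to_rem | exact: p_all | exact: sub].
Qed.

Lemma fan_edge_consecutive x y ps s l1 p q l2 :
  uniq (x :: rcons s y) -> s \in [::] :: ps -> x :: rcons s y = l1 ++ p :: q :: l2 ->
  fan_edge x y ps p q /\ fan_edge x y ps q p.
Proof.
move=> U sps Fdef; rewrite Fdef in U.
have idx : (index p (x :: rcons s y)).+1 = index q (x :: rcons s y).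
  move: U; rewrite Fdef cat_uniq !index_cat /= !eqxx => /and4P[_].
  rewrite !inE !negb_or => /and3P[/negPf-> /negPf-> _] /andP[npq _] _.
  by rewrite (negPf npq) addn0 addn1.
have pqF : (p \in x :: rcons s y) * (q \in x :: rcons s y).
  by rewrite Fdef !mem_cat !inE !eqxx !orbT.
by split; apply/hasP; exists s; rewrite //= !pqF idx eqxx ?orbT.
Qed.

Lemma fan_uniq_path B x y ps s : is_fan B x y ps -> s \in [::] :: ps -> uniq (x :: rcons s y).
Proof.
case=> _ _ _ U _; rewrite inE => /orP[/eqP->|sps]; first by uniq_by U.
have /permP eps : perm_eq (flatten ps) (s ++ flatten (rem s ps)).
  exact: perm_flatten (perm_to_rem sps).
by apply: (uniq_count_leq _ U) => z; rewrite /= -cats1 eps !count_cat; count_lia.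
Qed.

(** With [Q = [::]] this also classifies single edges between vertices of the fan: such an edge is
    in the fan unless it yields a K4 or a larger fan. *)
Lemma fan_ear B x y ps u w Q : is_fan B x y ps ->
  u \in x :: y :: flatten ps -> w \in x :: y :: flatten ps -> u != w ->
  uniq (x :: y :: flatten ps ++ Q) -> {subset Q <= B} -> path e u (rcons Q w) ->
  [\/ Q = [::] /\ fan_edge x y ps u w,
      exists2 K : {set T}, K4_on e K & {subset K <= B} | larger_fan B ps].
Proof.
move=> fan uin win nuw UQ QB pQ; have [exy ps0 _ _ sB] := fan.
have U_perm ps' : perm_eq ps ps' -> uniq (x :: y :: flatten ps' ++ Q).
  move=> /perm_flatten/permP eps; apply: (uniq_count_leq _ UQ) => z.
  by rewrite /= !count_cat eps.
have [[s [ps' [eps us ws]]]|[s [s' [ps' [eps us ws]]]]] := fan_two_points ps0 uin win.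
  have fan' := fan_perm eps fan; have UQ' := U_perm _ eps.
  have sL : s \in [::] :: ps by rewrite inE (perm_mem eps) mem_head orbT.
  have UF := fan_uniq_path fan sL.
  have larger' : larger_fan B (s :: ps') -> larger_fan B ps.
    by apply: larger_fan_perm; rewrite perm_sym.
  (* Either the two points are consecutive on [s], or they are [x] and [y], joined by the base
     edge. *)
  have endpoints l1 p m q l2 : x :: rcons s y = l1 ++ p :: m ++ q :: l2 ->
      m = [::] \/ l1 = [::] /\ l2 = [::] ->
      fan_edge x y ps p q /\ fan_edge x y ps q p.
    move=> Fdef [m0|[l10 l20]]; first by apply: (@fan_edge_consecutive _ _ _ s l1 p q l2) => //; rewrite Fdef m0.
    apply: (@fan_edge_consecutive _ _ _ [::] [::] _ _ [::]) => //.
      exact: fan_uniq_path fan _.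
    by move: Fdef; rewrite l10 l20 cats1 -rcons_cons => -[-> /rcons_inj[_ ->]].
  have [l1 [m [l2 [Fdef|Fdef]]]] := split_two us ws nuw.
    have [[Q0 h]|/larger'] := ear_same_path fan' Fdef UQ' QB pQ; last by constructor 3.
    by constructor 1; split=> //; case: (endpoints _ _ _ _ _ Fdef h).
  (* Here [w] precedes [u] on [s], so the ear is traversed backwards. *)
  have [|||[Q0 h]|/larger'] := ear_same_path (Q := rev Q) fan' Fdef; last by constructor 3.
  - by uniq_by UQ'.
  - by move=> z; rewrite mem_rev; apply: QB.
  - by rewrite -path_rev_rcons.
  constructor 1; split; first by rewrite -(revK Q) Q0.
  by case: (endpoints _ _ _ _ _ Fdef h).
constructor 2; exists [set x; y; u; w].
  case/splitPr: us eps => a b; case/splitPr: ws => c d eps.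
  exact: ear_two_paths (fan_perm eps fan) (U_perm _ eps) pQ.
move=> z; rewrite !inE -!orbA => /or4P[] /eqP->; apply: sB => //; by rewrite !inE eqxx ?orbT.
Qed.

End Fans.

(** * Ears and odd cycles in 2-connected graphs *)

Section Connectivity.
Variables (T : finType) (e : rel T).
Hypotheses (e_sym : symmetric e) (e_irr : irreflexive e).

Lemma connect_crossing (r : rel T) (H : {set T}) x y :
  connect r x y -> x \in H -> y \notin H -> exists a b, [/\ a \in H, b \notin H & r a b].
Proof.
case/connectP=> p + ->; elim: p x => [|z p IHp] x /=; first by move=> _ ->.
case/andP=> rxz pz xH; case: (boolP (z \in H)) => [zH|zH _]; first exact: IHp.
by exists x, z.
Qed.

Lemma path_first_hit (r : rel T) (H : {set T}) x p :
  path r x p -> x \notin H -> last x p \in H ->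
  exists Q w p', [/\ p = rcons Q w ++ p', w \in H & {in Q, forall z, z \notin H}].
Proof.
elim: p x => [|z p IHp] x /=; first by move=> _ /negPf->.
case/andP=> _ pz xH lH; case: (boolP (z \in H)) => zH.
  by exists [::], z, p.
have [Q [w [p' [-> wH QH]]]] := IHp z pz zH lH.
exists (z :: Q), w, p'; split=> // t; rewrite inE => /orP[/eqP->//|]; exact: QH.
Qed.

Lemma path_induced (S : {set T}) x p : path (induced e S) x p -> path e x p /\ {subset p <= S}.
Proof.
elim: p x => [|z p IHp] x //= /andP[/and3P[xS zS ->] /IHp[-> pS]]; split=> // t.
by rewrite inE => /orP[/eqP->//|/pS].
Qed.

(** Connectedness gives an edge from some [u] in [H] to a vertex [b] outside. With [u] deleted, [b]
    is still joined to another vertex of [H]; a simple path cut at its first return to [H] gives the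
    ear, and avoiding [u] makes its ends distinct. *)
Lemma ear_exists (B H : {set T}) v : two_connected_on e B -> H \subset B -> 1 < #|H| ->
  v \in B -> v \notin H ->
  exists u w Q, [/\ u \in H, w \in H, u != w & Q != [::]] /\
    [/\ path e u (rcons Q w), uniq Q, {subset Q <= B} & {in Q, forall z, z \notin H}].
Proof.
case=> _ [cB cB'] /subsetP HB H2 vB vH.
have /card_gt0P[h0 h0H] : 0 < #|H| by apply: leq_trans H2.
have [u [b [uH bH /and3P[uB bB eub]]]] := connect_crossing (cB _ _ (HB _ h0H) vB) h0H vH.
have /card_gt0P[h] : 0 < #|H :\ u| by move: H2; rewrite (cardsD1 u) uH.
rewrite !inE => /andP[hu hH].
have bu : b != u by apply: contraNneq bH => ->.
have /connectP[p0 pp0 hE] : connect (induced e (B :\ u)) b h.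
  by apply: cB'; rewrite // !inE ?bu ?hu // HB.
case/shortenP: pp0 hE => p pp Up _ hE.
have [Q [w [p' [pE wH QH]]]] : exists Q w p',
    [/\ p = rcons Q w ++ p', w \in H & {in Q, forall z, z \notin H}].
  by apply: (path_first_hit pp bH); rewrite -hE.
move: pp Up; rewrite pE cat_path => /andP[/path_induced[pQ QB] _].
rewrite -cat_cons cat_uniq => /andP[Up _].
exists u, w, (b :: Q); split; split=> //.
- by apply/eqP=> uw; have := QB w; rewrite mem_rcons mem_head !inE uw eqxx => /(_ isT).
- by rewrite /= eub.
- by move: Up; rewrite -rcons_cons rcons_uniq => /andP[].
- move=> z; rewrite inE => /orP[/eqP->//|zQ].
  by have := QB z; rewrite mem_rcons inE zQ orbT !inE => /(_ isT)/andP[].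
- by move=> z; rewrite inE => /orP[/eqP->//|/QH].
Qed.

Lemma not_uniq_split (U : eqType) (s : seq U) :
  ~~ uniq s -> exists a z b d, s = a ++ z :: b ++ z :: d.
Proof.
elim: s => //= x s IHs; rewrite negb_and negbK => /orP[|/IHs[a [z [b [d ->]]]]].
  by case/splitPr=> b d; exists [::], x, b, d.
by exists (x :: a), z, b, d.
Qed.

(** A repeated vertex [z] splits the closed walk into two shorter ones, exactly one of them odd. *)
Lemma odd_closed_walk_cycle c : cycle e c -> odd (size c) ->
  exists2 c', is_odd_cycle e c' & {subset c' <= c}.
Proof.
elim/ltn_ind: {c}(size c) {-2}c (erefl (size c)) => n IHn c szc cc oc.
have [Uc|/not_uniq_split[a [z [b [d cE]]]]] := boolP (uniq c).
  exists c => //; apply: is_odd_cycleE => //.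
  (* An odd closed walk of length 1 would be a loop. *)
  by case: c cc oc {szc Uc IHn} => [|x [|y [|? ?]]] //=; rewrite e_irr.
have rotE : rot (size a) c = z :: b ++ z :: d ++ a by rewrite cE rot_size_cat /= -catA.
have := cc; rewrite -(rot_cycle (size a)) rotE cycle_cat2 => /andP[pb pd].
have szE : size c = size (z :: b) + size (z :: d ++ a) by rewrite -(size_rot (size a)) rotE -size_cat.
have memE : c =i z :: b ++ z :: d ++ a by move=> t; rewrite -rotE mem_rot.
case: (boolP (odd (size (z :: b)))) => ob.
  have [|c' oc' sub] := IHn _ _ (z :: b) erefl pb ob.
    by rewrite -szc szE -[ltnLHS]addn0 ltn_add2l.
  by exists c' => // t /sub tin; rewrite memE -cat_cons mem_cat tin.
have od : odd (size (z :: d ++ a)) by move: oc; rewrite szE oddD (negPf ob).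
have [|c' oc' sub] := IHn _ _ (z :: d ++ a) erefl pd od.
  by rewrite -szc szE -[ltnLHS]add0n ltn_add2r.
by exists c' => // t /sub tin; rewrite memE -cat_cons mem_cat tin orbT.
Qed.

(* A path of length n from (v, a) to (w, b) is a walk from v to w in B, with
   b = a (+) odd n. *)
Definition parity_cover (B : {set T}) : rel (T * bool) :=
  fun p q => induced e B p.1 q.1 && (p.2 != q.2).

Lemma parity_cover_path B a p : path (parity_cover B) a p ->
  path (induced e B) a.1 (map fst p) /\ (last a p).2 = a.2 (+) odd (size p).
Proof.
elim: p a => [|q p IHp] a /=; first by rewrite addbF.
case/andP=> /andP[-> naq] /IHp[-> ->]; split=> //.
by move: naq; case: a.2; case: q.2; case: (odd _).
Qed.

Lemma connect_parity_cover B x y : connect (induced e B) x y ->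
  exists b, connect (parity_cover B) (x, false) (y, b).
Proof.
case/connectP=> p; elim/last_ind: p y => [|p z IHp] y.
  by move=> _ ->; exists false; apply: connect0.
rewrite rcons_path last_rcons => /andP[pp ez] ->.
have [b cb] := IHp _ pp erefl; exists (~~ b).
by apply: connect_trans cb (connect1 _); rewrite /parity_cover /= ez; case: b.
Qed.

(** [parity_cover] is the bipartite double cover. If it joins the two copies of some [v], this is an
    odd closed walk; otherwise the copy of a vertex that is reachable from a root defines a proper
    colouring. *)
Lemma bipartite_or_odd_cycle (B : {set T}) : connected_on e B ->
  bipartite_on e B \/ exists2 c, is_odd_cycle e c & {subset c <= B}.
Proof.
move=> cB; have sym2 : connect_sym (parity_cover B).
  apply: sym_connect_sym => p q.
  by rewrite /parity_cover /induced andbCA e_sym eq_sym.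
have [/existsP[v /connectP[p pp lE]]|nex] :=
  boolP [exists v, connect (parity_cover B) (v, false) (v, true)].
  right; have [/path_induced[pe pB] /=] := parity_cover_path pp.
  rewrite -lE /=; case/lastP: p pp lE pe pB => // p q _.
  rewrite last_rcons => <-; rewrite map_rcons /= => pe pB oq.
  have [||c oc sub] := @odd_closed_walk_cycle (v :: map fst p).
  - exact: pe.
  - by rewrite /= size_map; move: oq; rewrite size_rcons /= => <-.
  exists c => // t /sub tin; apply: pB; rewrite mem_rcons; exact: tin.
left; have [->|[r rB]] := set_0Vmem B.
  by exists (fun=> true) => x y; rewrite inE.
exists (fun v => connect (parity_cover B) (r, false) (v, true)) => x y xB yB exy.
have step b : connect (parity_cover B) (r, false) (x, b) ->
    connect (parity_cover B) (r, false) (y, ~~ b).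
  move=> cb; apply: connect_trans cb (connect1 _).
  by rewrite /parity_cover /induced /= xB yB exy; case: b.
have not_both v : connect (parity_cover B) (r, false) (v, false) ->
    connect (parity_cover B) (r, false) (v, true) -> False.
  rewrite sym2 => c1 c2; move/existsP: nex; apply; exists v.
  exact: connect_trans c1 c2.
(* Some copy of [x] is reachable, by [not_both] only one, and [step] leads to the opposite copy of
   [y]. *)
have [b cb] := connect_parity_cover (cB _ _ rB xB).
case: b cb => cb; have := step _ cb => cy; apply/eqP.
  by rewrite cb => /esym; exact: not_both cy.
by rewrite cy => cx; exact: not_both cb cx.
Qed.

Section Gstar.
Hypothesis eG : inGstar e.

(** Suppose an ear [Q] joins [u] and [w] in [K], and let [a], [b] be the other two vertices. If
    [size Q] is odd, the edge [uw] and the path through [a] and [b] force [Q] to be empty; if it is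
    even, the edge [uw] and [Q] force the path through [a] to have no inner vertex. *)
Lemma K4_two_connected (B K : {set T}) : two_connected_on e B -> K4_on e K ->
  {subset K <= B} -> K4_on e B.
Proof.
move=> B2 [K4 eK] KB; have sKB : K \subset B by apply/subsetP.
have [->//|nKB] := eqVneq B K; case: notF.
have /subsetPn[v vB vK] : ~~ (B \subset K).
  by apply: contra nKB => sBK; rewrite eqEsubset sBK.
have [|u [w [Q [[uK wK nuw Q0] [pQ UQ QB QK]]]]] := ear_exists B2 sKB _ vB vK.
  by rewrite K4.
have : #|K :\ u :\ w| == 2.
  by move: K4; rewrite (cardsD1 u K) uK (cardsD1 w (K :\ u)) !inE (eq_sym w) nuw wK /= !add1n => -[->].
case/cards2P=> a [b [nab /setP KE]].
have [aw au aK] : [/\ a != w, a != u & a \in K].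
  by have := KE a; rewrite !inE eqxx => /and3P.
have [bw bu bK] : [/\ b != w, b != u & b \in K].
  by have := KE b; rewrite !inE eqxx orbT => /and3P.
have notQ z : z \in K -> z \notin Q by move=> zK; apply/negP=> /QK; rewrite zK.
have U : uniq (u :: w :: a :: b :: Q).
  by rewrite /= UQ !inE !negb_or nuw nab ![_ == a]eq_sym ![_ == b]eq_sym au aw bu bw !notQ.
have edge p q : p \in K -> q \in K -> p != q -> e p q by exact: eK.
have ewu : path e u (rcons [::] w) by rewrite /= edge.
have [oQ|oQ] := boolP (odd (size Q)).
  suff Q0' : Q = [::] by rewrite Q0' in Q0.
  apply: (@theta_arc_nil _ _ e_sym eG u w Q [::] [:: a; b]) => //; first by uniq_by U.
    by rewrite /= !edge // eq_sym.
  - by rewrite oQ.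
  - by rewrite oQ.
suff : [:: a] = [::] by [].
apply: (@theta_arc_nil _ _ e_sym eG u w [:: a] [::] Q) => //; first by uniq_by U.
by rewrite /= !edge // eq_sym.
Qed.

(** The edge closing the list [c], from its last vertex to its first, serves as base, and the rest
    of the cycle as the only path. *)
Lemma odd_cycle_fan (B : {set T}) c : is_odd_cycle e c -> {subset c <= B} ->
  exists x y s, is_fan e B x y [:: s].
Proof.
case/andP=> /andP[]; case: c => [|x [|a c]] // sz /andP[cc Uc] oc sub.
case/lastP: c sz cc Uc oc sub => // c y _ cc Uc oc sub.
exists x, y, (a :: c); split=> //.
- by move: cc; rewrite (e_sym x) /= rcons_path last_rcons => /and3P[].
- move: cc oc; rewrite /= rcons_path !size_rcons /= !negbK => /and3P[-> -> _] ->.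
  by [].
- by uniq_by Uc.
- by move=> z; rewrite /= cats0 => zin; apply: sub; move: zin; rewrite !inE mem_rcons !inE;
    do !case: (_ == _); rewrite ?orbT.
Qed.

(** Induction on the number of vertices not yet used: a vertex outside the fan gives a nonempty ear
    by [ear_exists], and [fan_ear] then yields a K4 or a larger fan. *)
Lemma fan_exhausts (B : {set T}) x y ps : two_connected_on e B -> is_fan e B x y ps ->
  K4_on e B \/ exists x y ps, [/\ is_fan e B x y ps, B =i x :: y :: flatten ps &
     {in B &, forall p q, e p q -> fan_edge x y ps p q}].
Proof.
move=> B2; move: {-1}(#|B| - size (flatten ps)) (erefl (#|B| - size (flatten ps))) => n.
elim/ltn_ind: n x y ps => n IHn x y ps nE fan.
have [exy ps0 _ U sB] := fan.
have grow : larger_fan e B ps -> K4_on e B \/ exists x y ps,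
    [/\ is_fan e B x y ps, B =i x :: y :: flatten ps &
     {in B &, forall p q, e p q -> fan_edge x y ps p q}].
  case=> x' [y' [ps' [fan' lt_ps]]].
  have [_ _ _ U' sB'] := fan'; apply: IHn (erefl _) fan'.
  (* The larger fan still fits into [B], so the truncated difference really decreases. *)
  have := uniq_leq_size U' (s2 := enum B); rewrite -cardE /=.
  have sub' : {subset x' :: y' :: flatten ps' <= enum B} by move=> z /sB'; rewrite mem_enum.
  move/(_ sub'); rewrite -nE; move: lt_ps; goal_lia.
have K4B : (exists2 K : {set T}, K4_on e K & {subset K <= B}) -> K4_on e B.
  by case=> K K4 KB; exact: K4_two_connected KB.
pose H := [set z in x :: y :: flatten ps].
have sHB : H \subset B by apply/subsetP=> z; rewrite inE => /sB.
have [HB|nHB] := boolP (B \subset H); last first.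
  have /subsetPn[v vB vH] := nHB.
  have [|u [w [Q [[uH wH nuw Q0] [pQ UQ QB QH]]]]] := ear_exists B2 sHB _ vB vH.
    have -> : #|H| = size (x :: y :: flatten ps) by rewrite -(card_uniqP U); apply: eq_card => z; rewrite inE.
    by [].
  have UHQ : uniq (x :: y :: flatten ps ++ Q).
    rewrite -!cat_cons cat_uniq U UQ andbT; apply/hasPn => z /QH.
    by rewrite inE.
  rewrite !inE -!in_cons in uH wH.
  have [[Q0' _]|/K4B|/grow] // := fan_ear e_sym eG fan uH wH nuw UHQ QB pQ.
    by rewrite Q0' in Q0.
  by left.
have BE : B =i x :: y :: flatten ps.
  by move=> z; apply/idP/idP => [/(subsetP HB)|/sB //]; rewrite inE.
have [/forallP all_fan|/forallPn[p /forallPn[q]]] :=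
  boolP [forall p, forall q, [&& p \in B, q \in B & e p q] ==> fan_edge x y ps p q].
  right; exists x, y, ps; split=> // p q pB qB epq.
  by have /forallP/(_ q) := all_fan p; rewrite pB qB epq.
rewrite negb_imply => /andP[/and3P[pB qB epq] nfan].
have npq : p != q by apply: contraTneq epq => ->; rewrite e_irr.
rewrite !BE in pB qB.
(* An edge missing from the fan is an ear without inner vertices. *)
have [|||[_]|/K4B|/grow] // := fan_ear (Q := [::]) e_sym eG fan pB qB npq.
- by rewrite cats0.
- by rewrite /= epq.
- by rewrite (negPf nfan).
- by left.
Qed.

End Gstar.
End Connectivity.

(** * Odd cycles and blocks *)

Section CycleEdges.
Variables (T : finType) (e : rel T).
Hypotheses (e_sym : symmetric e) (e_irr : irreflexive e).

(** Otherwise the colour changes at every step, and one round of odd length would return to the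
    start with the opposite colour. This serves both bipartite blocks and theta graphs. *)
Lemma odd_cycle_monochromatic (col : T -> bool) c : is_odd_cycle e c ->
  exists2 v, v \in c & col v = col (next c v).
Proof.
case/andP=> /andP[sz /andP[cc Uc]] oc.
have [/hasP[v vc /eqP]|/hasPn nmono] := boolP (has (fun v => col v == col (next c v)) c).
  by exists v.
have : cycle (fun a b => col a != col b) c by exact: cycle_from_next.
have parity x p : path (fun a b => col a != col b) x p -> col (last x p) = col x (+) odd (size p).
  elim: p x => [|y p IHp] x /=; first by rewrite addbF.
  by case/andP=> + /IHp ->; case: (col x); case: (col y); case: (odd _).
case: c sz oc {cc Uc nmono} => // x p _ oc /parity.
by rewrite last_rcons size_rcons -[(size p).+1]/(size (x :: p)) oc; case: (col x).
Qed.

Lemma odd_cycle_not_bipartite (B : {set T}) c : is_odd_cycle e c -> {subset c <= B} ->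
  ~ bipartite_on e B.
Proof.
move=> oc sub [f fB]; have [v vc fv] := odd_cycle_monochromatic f oc.
have /andP[/andP[_ /andP[cc _]] _] := oc.
by have := fB v (next c v); rewrite !sub ?mem_next // (next_cycle cc vc) fv eqxx => /(_ isT isT isT).
Qed.

Lemma cedges_prev (c : seq T) v : uniq c -> v \in c -> [set v; prev c v] \in cedges c.
Proof.
by move=> Uc vc; rewrite setUC -{2}(prev_next Uc v) -{2}(next_prev Uc v) prev_next // cedges_next // mem_prev.
Qed.

Lemma cycle_edge_prev (c : seq T) v : cycle e c -> v \in c -> e v (prev c v).
Proof. by move=> cc vc; rewrite e_sym prev_cycle. Qed.

Lemma next_neq_prev (c : seq T) v : 2 < size c -> uniq c -> v \in c -> next c v != prev c v.
Proof.
move=> sz Uc vc; have [i p cE] := rot_to vc.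
have Up : uniq (v :: p) by rewrite -cE rot_uniq.
have szp : 2 < size (v :: p) by rewrite -cE size_rot.
apply/eqP=> eq_np; have := next_prev Uc v.
rewrite -eq_np -!(next_rot i Uc) cE; case: p Up szp {cE} => [|a [|b p]] //= Up _.
move: Up; rewrite !inE !negb_or => /andP[/and3P[va vb _] _].
by rewrite !eqxx eq_sym (negPf va) => bv; rewrite bv eqxx in vb.
Qed.

Lemma cedges_neighbor (c : seq T) v w : uniq c -> [set v; w] \in cedges c -> v != w ->
  w = next c v \/ w = prev c v.
Proof.
move=> Uc /imsetP[x xc /setP E] nvw.
have := E v; have := E w; rewrite !inE !eqxx orbT /=.
case/esym/orP=> /eqP wx /esym/orP[]/eqP vx.
- by rewrite wx vx eqxx in nvw.
- by right; rewrite vx wx prev_next.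
- by left; rewrite vx.
- by rewrite wx vx eqxx in nvw.
Qed.

End CycleEdges.

Section Blocks.
Variables (T : finType) (e : rel T).
Hypotheses (e_sym : symmetric e) (e_irr : irreflexive e).

Lemma connect_induced_sub (S S' : {set T}) x y : S \subset S' ->
  connect (induced e S) x y -> connect (induced e S') x y.
Proof.
move=> /subsetP sSS'; apply: connect_sub => a b /and3P[aS bS eab].
by apply: connect1; rewrite /induced !sSS'.
Qed.

Lemma connect_induced_sym (S : {set T}) : connect_sym (induced e S).
Proof. by apply: sym_connect_sym => x y; rewrite /induced e_sym andbCA. Qed.

Lemma connect_induced_path (S : {set T}) x p : path e x p -> {subset x :: p <= S} ->
  connect (induced e S) x (last x p).
Proof.
elim: p x => [|y p IHp] x /=; first by move=> _ _; apply: connect0.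
case/andP=> exy py sub; have /(IHp y py) : {subset y :: p <= S}.
  by move=> z zp; apply: sub; rewrite inE zp orbT.
by apply: connect_trans; apply: connect1; rewrite /induced exy !sub // !inE eqxx ?orbT.
Qed.

Lemma connected_path x p : path e x p -> connected_on e [set z in x :: p].
Proof.
move=> px; set S := [set z in _].
have from_x z : z \in S -> connect (induced e S) x z.
  rewrite inE => zp; case/splitPl: zp px @S => p1 p2 <-.
  rewrite cat_path => /andP[p1x _] S; apply: connect_induced_path p1x _ => t.
  by rewrite !inE mem_cat orbA => ->.
move=> y z /from_x; rewrite connect_induced_sym => yx /from_x; exact: connect_trans.
Qed.

Lemma connectedU (S1 S2 : {set T}) z : z \in S1 -> z \in S2 ->
  connected_on e S1 -> connected_on e S2 -> connected_on e (S1 :|: S2).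
Proof.
move=> z1 z2 c1 c2.
have to_z x : x \in S1 :|: S2 -> connect (induced e (S1 :|: S2)) x z.
  rewrite inE => /orP[xS|xS].
    by apply: (connect_induced_sub (subsetUl _ _)); apply: c1.
  by apply: (connect_induced_sub (subsetUr _ _)); apply: c2.
move=> x y /to_z xz /to_z; rewrite connect_induced_sym; exact: connect_trans.
Qed.

Lemma two_connected_del (S : {set T}) v : two_connected_on e S -> connected_on e (S :\ v).
Proof.
case=> _ [cS cSv]; have [vS|vS] := boolP (v \in S); first exact: cSv.
by rewrite (setDidPl _) // disjoint_sym disjoints1.
Qed.

(** After the deletion of any vertex a common vertex remains to link the two parts. *)
Lemma two_connectedU (S1 S2 : {set T}) : 1 < #|S1 :&: S2| ->
  two_connected_on e S1 -> two_connected_on e S2 -> two_connected_on e (S1 :|: S2).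
Proof.
move=> I2 S1c S2c; split.
  by case: S1c => + _; move/leq_trans; apply; rewrite subset_leq_card ?subsetUl.
have /card_gt0P[z] : 0 < #|S1 :&: S2| by apply: leq_trans I2.
rewrite inE => /andP[z1 z2]; split; first by apply: (connectedU z1 z2); [case: S1c => _ [] | case: S2c => _ []].
move=> v _; have /card_gt0P[t] : 0 < #|(S1 :&: S2) :\ v|.
  by move: I2; rewrite (cardsD1 v (S1 :&: S2)); case: (v \in _); rewrite ?add0n // => /ltnW.
rewrite !inE => /and3P[tv t1 t2]; rewrite setDUl.
by apply: (@connectedU _ _ t); rewrite ?inE ?tv //; apply: two_connected_del.
Qed.

(** Rotating the cycle to start at the deleted vertex leaves a path. *)
Lemma cycle_two_connected c : is_cycle e c -> two_connected_on e [set z in c].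
Proof.
case/andP=> sz /andP[cc Uc].
have cE : #|[set z in c]| = size c by rewrite -(card_uniqP Uc); apply: eq_card => z; rewrite inE.
split; first by rewrite cE.
split.
  case: c cc {sz Uc cE} => [|x p] cc; first by move=> x y; rewrite inE.
  by apply: connected_path; move: cc; rewrite /= rcons_path => /andP[].
move=> v; rewrite inE => vc; have [i p pE] := rot_to vc.
have : cycle e (v :: p) by rewrite -pE rot_cycle.
have : uniq (v :: p) by rewrite -pE rot_uniq.
have -> : [set z in c] :\ v = [set z in v :: p] :\ v.
  by apply/setP=> z; rewrite !inE -[z \in c](mem_rot i) pE inE.
case: p {pE} => [|a p] /andP[vp _].
  by move=> _ x y; rewrite !inE; case: eqP.
rewrite /= rcons_path => /and3P[_ pa _].
have -> : [set z in v :: a :: p] :\ v = [set z in a :: p].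
  apply/setP=> z; rewrite !inE; case: eqVneq => //= ->.
  by move: vp; rewrite !inE => /negPf->.
exact: connected_path.
Qed.

Lemma block_exists (S : {set T}) : two_connected_on e S ->
  exists2 B, is_block e B & S \subset B.
Proof.
(* [maxset] needs boolean predicates, so connectivity is restated as such. *)
pose conn (S : {set T}) := [forall x in S, forall y in S, connect (induced e S) x y].
pose two_conn (S : {set T}) := [&& 2 < #|S|, conn S & [forall v in S, conn (S :\ v)]].
have connP S' : reflect (connected_on e S') (conn S').
  apply: (iffP forall_inP) => [h x y xS yS|h x xS]; first by have /forall_inP := h x xS; apply.
  by apply/forall_inP => y; apply: h.
have two_connP S' : reflect (two_connected_on e S') (two_conn S').
  apply: (iffP and3P) => [[h1 /connP h2 /forall_inP h3]|[h1 [/connP h2 h3]]].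
    by split=> //; split=> // v /h3/connP.
  by split=> //; apply/forall_inP => v /h3/connP.
move/two_connP/maxset_exists=> [B /maxsetP[/two_connP B2 Bmax] sSB].
exists B => //; split=> // S' /properP[sBS' [z zS' zB]] /two_connP S'2.
by rewrite -(Bmax _ S'2 sBS') zS' in zB.
Qed.

Lemma cedges_card2 c E : is_cycle e c -> E \in cedges c -> #|E| = 2.
Proof.
case/andP=> _ /andP[cc _] /imsetP[x xc ->].
by rewrite cards2; have := next_cycle cc xc; case: eqP => // <-; rewrite e_irr.
Qed.

(** The two ends of a shared edge are the common vertices that [two_connectedU] asks for. *)
Lemma odd_cycles_in_block c1 c2 : is_odd_cycle e c1 -> is_odd_cycle e c2 ->
  1 < #|cedges c1 :&: cedges c2| ->
  exists B, [/\ is_block e B, {subset c1 <= B} & {subset c2 <= B}].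
Proof.
move=> /andP[cy1 _] /andP[cy2 _] /card_gt1P[E [F [/setIP[E1 E2] _ _]]].
have [|B Bb /subUsetP[/subsetP s1 /subsetP s2]] := @block_exists ([set z in c1] :|: [set z in c2]).
  apply: two_connectedU; [|exact: cycle_two_connected..].
  rewrite -(cedges_card2 cy1 E1) subset_leq_card //; apply/subsetP=> z zE.
  by rewrite !inE (cedges_mem E1 zE) (cedges_mem E2 zE).
by exists B; split=> // z zc; [apply: s1 | apply: s2]; rewrite inE.
Qed.

(** Any two vertices of a triangle are consecutive, so its edges are determined by its vertex
    set. *)
Lemma triangle_cedges c E : is_odd_cycle e c -> size c = 3 ->
  (E \in cedges c) = (E \subset [set z in c]) && (#|E| == 2).
Proof.
move=> /andP[cy _] sz; apply/idP/andP => [Ec|[/subsetP Ec /cards2P[a [b [nab EE]]]]].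
  by rewrite (cedges_card2 cy Ec); split=> //; apply/subsetP=> z; rewrite inE; apply: cedges_mem.
have /andP[_ /andP[_ Uc]] := cy.
have ac : a \in c by have := Ec a; rewrite EE !inE eqxx; apply.
have bc : b \in c by have := Ec b; rewrite EE !inE eqxx orbT; apply.
suff : b = next c a \/ b = prev c a.
  by rewrite EE; case=> ->; [exact: cedges_next | exact: cedges_prev].
have [i p pE] := rot_to ac; have := bc; rewrite -(mem_rot i) pE.
have szp : size (a :: p) = 3 by rewrite -pE size_rot.
have Up : uniq (a :: p) by rewrite -pE rot_uniq.
rewrite -(next_rot i Uc) -(prev_rot i Uc) pE.
case: p szp Up {pE} => [|d [|f []]] // _ Up.
rewrite !inE [b == a]eq_sym (negPf nab) orFb => /orP[]/eqP ->; first by left; rewrite /= eqxx.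
right; rewrite -[LHS](prev_next Up); congr prev.
by move: Up; rewrite /= !inE !negb_or => /and3P[/andP[ad af] df _]; rewrite ![f == _]eq_sym (negPf af) (negPf df) eqxx.
Qed.

(** Odd cycles on four vertices are triangles. Distinct ones have at most two common vertices, so a
    common edge must be the whole intersection of their vertex sets. *)
Lemma K4_odd_cycles (B : {set T}) c1 c2 : K4_on e B ->
  is_odd_cycle e c1 -> is_odd_cycle e c2 -> {subset c1 <= B} -> {subset c2 <= B} ->
  cedges c1 != cedges c2 -> #|cedges c1 :&: cedges c2| <= 1.
Proof.
case=> B4 _ oc1 oc2 s1 s2 n12.
have size3 c : is_odd_cycle e c -> {subset c <= B} -> size c = 3.
  case/andP=> /andP[sz /andP[_ Uc]] oc sub.
  have := uniq_leq_size Uc (s2 := enum B); rewrite -cardE B4.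
  have sub' : {subset c <= enum B} by move=> z /sub; rewrite mem_enum.
  move/(_ sub'); move: (size c) sz oc; do 5!case=> //.
have szc1 := size3 _ oc1 s1; have szc2 := size3 _ oc2 s2.
pose S1 := [set z in c1]; pose S2 := [set z in c2].
have cardS c : is_odd_cycle e c -> #|[set z in c]| = size c.
  by case/andP=> /andP[_ /andP[_ Uc]] _; rewrite -(card_uniqP Uc); apply: eq_card => z; rewrite inE.
have I2 : #|S1 :&: S2| <= 2.
  rewrite leqNgt; apply: contra n12 => I3; apply/eqP/setP=> E.
  rewrite !triangle_cedges // -/S1 -/S2.
  have eq1 : S1 :&: S2 = S1 by apply/eqP; rewrite eqEcard subsetIl cardS // szc1.
  have eq2 : S1 :&: S2 = S2 by apply/eqP; rewrite eqEcard subsetIr cardS // szc2.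
  by rewrite -[S1]eq1 eq2.
apply/card_le1_eqP => E F /setIP[E1 E2] /setIP[F1 F2].
have eqI G : G \in cedges c1 -> G \in cedges c2 -> G = S1 :&: S2.
  rewrite !triangle_cedges // => /andP[G1 /eqP G2] /andP[G3 _].
  by apply/eqP; rewrite eqEcard subsetI G1 G3 G2.
by rewrite (eqI E) // (eqI F).
Qed.

End Blocks.

(** * Theta graphs *)

(** An isomorphism is handier as an embedding [g] of the model graph, since cycles then have the
    form [map g c']. *)
Lemma iso_on_codom (T : finType) (e : rel T) (S : {set T}) (U : finType) (eU : rel U) :
  iso_on e S U eU -> exists g : U -> T, [/\ injective g, codom g =i S &
    forall u v, e (g u) (g v) = eU u v].
Proof.
case=> f [f_inj fS fe].
have /fin_all_exists[g gE] : forall u, exists t, t \in S /\ f t = u.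
  move=> u; have : u \in f @: S by rewrite fS.
  by case/imsetP=> t tS ->; exists t.
exists g; split.
- by move=> u v /(congr1 f); rewrite (gE u).2 (gE v).2.
- move=> t; apply/codomP/idP => [[u ->]|tS]; first by case: (gE u).
  by exists (f t); apply: f_inj; rewrite ?(gE _).1 ?(gE _).2.
- by move=> u v; rewrite fe ?(gE _).1 // !(gE _).2.
Qed.

Lemma codom_iso_on (T : finType) (e : rel T) (S : {set T}) (U : finType) (eU : rel U)
    (g : U -> T) (u0 : U) :
  injective g -> codom g =i S -> (forall u v, e (g u) (g v) = eU u v) -> iso_on e S U eU.
Proof.
(* [u0] is the value of [f] outside [S] only. *)
move=> g_inj gS ge; pose f t := odflt u0 [pick u | g u == t].
have fK u : f (g u) = u.
  by rewrite /f; case: pickP => [v /eqP/g_inj //|/(_ u)]; rewrite eqxx.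
have inS t : t \in S -> exists u, t = g u by rewrite -gS => /codomP.
exists f; split.
- by move=> s t /inS[u ->] /inS[v ->]; rewrite !fK => ->.
- apply/setP=> u; rewrite !inE; apply/imsetP; exists (g u); rewrite ?fK //.
  by rewrite -gS codom_f.
- by move=> s t /inS[u ->] /inS[v ->]; rewrite !fK.
Qed.

Lemma uniq_flatten_nth (T : eqType) (L : seq (seq T)) k i z :
  uniq (flatten L) -> k < size L -> i < size L ->
  z \in nth [::] L k -> z \in nth [::] L i -> k = i.
Proof.
elim: L k i => [|s L IHL] // k i; rewrite [flatten _]/= cat_uniq => /and3P[_ /hasPn dis UL].
have notin m : m < size L -> z \in s -> z \in nth [::] L m -> False.
  move=> mL zs zm; have /dis : z \in flatten L by apply/flattenP; exists (nth [::] L m); rewrite ?mem_nth.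
  by rewrite zs.
case: k i => [|k] [|i] //= kL iL zk zi.
- by case: (notin _ iL zk zi).
- by case: (notin _ kL zi zk).
- by congr _.+1; apply: IHL.
Qed.

(** * Recognizing a theta graph from its list of paths *)

Section ThetaOfPaths.
Variables (T : finType) (e : rel T) (B : {set T}) (x y : T) (L : seq (seq T)).
Hypotheses (U : uniq (x :: y :: flatten L)) (BE : B =i x :: y :: flatten L).
Let F s := x :: rcons s y.
Hypothesis eE : {in B &, forall p q, e p q =
  has (fun s => [&& p \in F s, q \in F s &
     ((index p (F s)).+1 == index q (F s)) || ((index q (F s)).+1 == index p (F s))]) L}.

Let ps := map (fun s => (size s).+1) L.

(** The labelling starts from the model graph, whose vertices carry their path and position; the
    defaults of [nth] are never reached, see [label_lt]. *)
Definition theta_label (v : theta_vertex ps) : T :=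
  match v with
  | inl b => if b then y else x
  | inr (existT k j) => nth x (nth [::] L k) j
  end.

Let size_ps : size ps = size L. Proof. exact: size_map. Qed.
Let nth_ps (k : 'I_(size ps)) : nth 0 ps k = (size (nth [::] L k)).+1.
Proof. by rewrite (nth_map [::]) // -size_ps. Qed.
Let xy : x != y. Proof. by move: U; rewrite /= inE negb_or => /andP[/andP[]]. Qed.
Let UL : uniq (flatten L). Proof. by uniq_by U. Qed.

Let in_path (k : 'I_(size ps)) z : z \in nth [::] L k ->
  [/\ z \in flatten L, z != x & z != y].
Proof.
move=> zk; have zL : z \in flatten L.
  by apply/flattenP; exists (nth [::] L k); rewrite ?mem_nth -?size_ps.
move: U; rewrite /= inE negb_or => /and3P[/andP[_ xL] yL _].
by split=> //; [apply: contraNneq xL | apply: contraNneq yL] => <-.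
Qed.

Let label_lt (k : 'I_(size ps)) (j : 'I_(nth 0 ps k).-1) : j < size (nth [::] L k).
Proof. by apply: leq_trans (ltn_ord j) _; rewrite nth_ps. Qed.

Let label_in (k : 'I_(size ps)) (j : 'I_(nth 0 ps k).-1) : nth x (nth [::] L k) j \in nth [::] L k.
Proof. exact: mem_nth. Qed.

Let uniq_F (k : 'I_(size ps)) : uniq (F (nth [::] L k)).
Proof.
have kL : nth [::] L k \in L by rewrite mem_nth -?size_ps.
have /permP eps : perm_eq (flatten L) (nth [::] L k ++ flatten (rem (nth [::] L k) L)).
  exact: perm_flatten (perm_to_rem kL).
by apply: (uniq_count_leq _ U) => z; rewrite /F /= -cats1 eps !count_cat; count_lia.
Qed.

(** Positions in the model graph are indices in the full vertex list [F]: [x] has index 0, which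
    shifts inner vertices by one, and [y] comes last. This matches [theta_rel] with the hypothesis
    [eE]. *)
Lemma theta_pos_label (v : theta_vertex ps) (i : 'I_(size ps)) :
  theta_pos ps v i = let Fi := F (nth [::] L i) in
    if theta_label v \in Fi then Some (index (theta_label v) Fi) else None.
Proof.
have UF := uniq_F i; case: v => [[]|[k j]] /=.
- rewrite inE mem_rcons mem_head orbT /= (negPf xy) nth_ps; congr (Some _.+1).
  move: UF; rewrite /= rcons_uniq -cats1 index_cat => /and3P[_ /negPf-> _].
  by rewrite /= eqxx addn0.
- by rewrite mem_head /= eqxx.
have [_ zx zy] := in_path (label_in j).
rewrite inE mem_rcons inE (negPf zx) (negPf zy) /= [x == _]eq_sym (negPf zx).
have [ki|nki] := eqVneq k i.
  rewrite -ki label_in -cats1 index_cat label_in index_uniq //.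
  by move: (uniq_F k); rewrite /= rcons_uniq => /and3P[].
case: ifP => // zi; case/eqP: nki; apply: val_inj.
by apply: (uniq_flatten_nth UL _ _ (label_in j) zi); rewrite -size_ps.
Qed.

Lemma theta_label_inj : injective theta_label.
Proof.
move=> [a|[k j]] [b|[k' j']] /=.
- by case: a b => [] [] // /eqP; rewrite ?[y == _]eq_sym (negPf xy).
- by have [_ zx zy] := in_path (label_in j'); case: a => /eqP; rewrite eq_sym ?(negPf zx) ?(negPf zy).
- by have [_ zx zy] := in_path (label_in j); case: b => /eqP; rewrite ?(negPf zx) ?(negPf zy).
move=> E; have kk' : k = k'.
  apply: val_inj; apply: (uniq_flatten_nth UL _ _ (label_in j) (_ : _ \in nth [::] L k'));
    rewrite -?size_ps; [exact: ltn_ord.. | rewrite E; exact: label_in].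
case: k' / kk' j' E => j' /eqP; rewrite nth_uniq ?label_lt //; first by move/eqP/val_inj ->.
by move: (uniq_F k); rewrite /= rcons_uniq => /and3P[].
Qed.

Lemma codom_theta_label : codom theta_label =i B.
Proof.
move=> t; rewrite BE; apply/codomP/idP => [[[[]|[k j]] ->] /=|].
- by rewrite !inE eqxx orbT.
- by rewrite mem_head.
- by have [zL _ _] := in_path (label_in j); rewrite !inE zL !orbT.
rewrite !inE => /or3P[/eqP->|/eqP->|/flattenP[s sL ts]].
- by exists (inl false).
- by exists (inl true).
have ks : index s L < size ps by rewrite size_ps index_mem.
have jt : index t s < (nth 0 ps (Ordinal ks)).-1 by rewrite nth_ps /= nth_index ?index_mem.
exists (inr (existT _ (Ordinal ks) (Ordinal jt))).
by rewrite /= nth_index // nth_index.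
Qed.

Lemma theta_of_paths : iso_on e B (theta_vertex ps) (theta_rel ps).
Proof.
apply: (codom_iso_on (inl false) theta_label_inj codom_theta_label) => u v.
rewrite eE -?codom_theta_label ?codom_f // /theta_rel.
apply/(has_nthP [::])/existsP => [[i iL h]|[i]].
  have ips : i < size ps by rewrite size_ps.
  by exists (Ordinal ips); rewrite !theta_pos_label /=; case/and3P: h => -> ->.
rewrite !theta_pos_label => h; exists i; first by rewrite -size_ps.
by move: h => /=; case: ifP => // _; case: ifP.
Qed.

End ThetaOfPaths.

(** * Odd cycles of a theta graph with one edge and even paths *)

Section ThetaGstar.
Variable ps : seq nat.
Hypothesis even_ps : all (fun p => (0 < p) && ~~ odd p) ps.
Let P := 1 :: ps.
Local Notation V := (theta_vertex P).
Local Notation pos := (theta_pos P).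
Implicit Types (i k : 'I_(size P)) (u v w : V).

Let P_gt0 i : 0 < nth 0 P i.
Proof.
case: i => [[|i] iP] //=; have := mem_nth 0 (iP : i < size ps).
by move/(allP even_ps)/andP=> [].
Qed.

Let P_even i : 0 < i -> ~~ odd (nth 0 P i).
Proof.
case: i => [[|i] iP] //= _; have := mem_nth 0 (iP : i < size ps).
by move/(allP even_ps)/andP=> [].
Qed.

Let P_gt1 i : 0 < i -> 1 < nth 0 P i.
Proof. by move=> i0; have := P_gt0 i; have := P_even i0; case: (nth 0 P i) => [|[|]]. Qed.

Lemma theta_pos_leq u i a : pos u i = Some a -> a <= nth 0 P i.
Proof.
case: u => [[]|[k j]] /=; [by case=> <-|by case=> <-|].
by case: eqP => // <- [<-]; apply: leq_trans (ltn_ord j) (leq_pred _).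
Qed.

Lemma theta_pos_lt u i a k j : u = inr (existT _ k j) -> pos u i = Some a ->
  k = i /\ 0 < a < nth 0 P i.
Proof.
move=> -> /=; case: eqP => // <- [<-]; split=> //=.
by rewrite -ltn_predRL; exact: ltn_ord.
Qed.

Lemma theta_pos_inj u v i a : pos u i = Some a -> pos v i = Some a -> u = v.
Proof.
have Pi := P_gt0 i.
case: u => [bu|[k j]] pu; case: v => [bv|[k' j']] pv.
- case: bu bv pu pv => [] [] //= [E1] [E2]; first by rewrite E1 -E2 in Pi.
  by rewrite E2 -E1 in Pi.
- have [_ /andP[a0 aP]] := theta_pos_lt erefl pv.
  by case: bu pu => /= -[E]; [rewrite -E ltnn in aP | rewrite -E in a0].
- have [_ /andP[a0 aP]] := theta_pos_lt erefl pu.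
  by case: bv pv => /= -[E]; [rewrite -E ltnn in aP | rewrite -E in a0].
move: pu pv => /=; case: eqP => // ki [<-]; case: eqP => // k'i [E].
subst k k'; congr (inr (existT _ _ _)); exact: val_inj.
Qed.

Lemma theta_pos_unique_path u i k a b : pos u i = Some a -> 0 < a < nth 0 P i ->
  pos u k = Some b -> k = i.
Proof.
case: u => [[]|[m j]] pi.
- by case: pi => <-; rewrite ltnn andbF.
- by case: pi => <-.
by have [<- _] := theta_pos_lt erefl pi => _ /(theta_pos_lt erefl)[<-].
Qed.

Definition theta_edge i (E : {set V}) : Prop :=
  exists u v a, [/\ E = [set u; v], pos u i = Some a & pos v i = Some a.+1].

Lemma theta_relP u v : theta_rel P u v ->
  exists i a, (pos u i = Some a /\ pos v i = Some a.+1) \/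
              (pos v i = Some a /\ pos u i = Some a.+1).
Proof.
case/existsP=> i; case Eu: (pos u i) => [a|//]; case Ev: (pos v i) => [b|//].
by case/orP=> /eqP h; exists i; [exists a; left | exists b; right]; rewrite h.
Qed.

Lemma theta_rel_sym : symmetric (theta_rel P).
Proof.
move=> u v; apply: eq_existsb => i.
by case: (pos u i) (pos v i) => [a|] [b|] //; rewrite orbC.
Qed.

Let ends : {set V} := [set inl false; inl true].

Lemma theta_edge0 i E : i = 0 :> nat -> theta_edge i E -> E = ends.
Proof.
move=> i0 [u [v [a [-> pu pv]]]].
have P1 : nth 0 P i = 1 by rewrite i0.
have := theta_pos_leq pv; rewrite P1 ltnS leqn0 => /eqP a0; rewrite a0 in pu pv.
rewrite (@theta_pos_inj u (inl false) i 0) // (@theta_pos_inj v (inl true) i 1) //.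
by rewrite /= P1.
Qed.

(** Parity of the position. Both ends get [false], which is consistent on every path of even length
    and fails only on path 0. *)
Definition theta_color (v : V) : bool :=
  match v with inl _ => false | inr (existT _ j) => odd j.+1 end.

Lemma theta_color_pos v i a : 0 < i -> pos v i = Some a -> theta_color v = odd a.
Proof.
move=> i0; case: v => [[]|[k j]] /=; [|by case=> <-|by case: eqP => // _ [<-]].
by case=> <-; rewrite (negPf (P_even i0)).
Qed.

Section OddCycle.
Variable c : seq V.
Hypothesis oc : is_odd_cycle (theta_rel P) c.
Let D := cedges c.

Let Uc : uniq c. Proof. by case/andP: oc => /andP[_ /andP[]]. Qed.
Let cc : cycle (theta_rel P) c. Proof. by case/andP: oc => /andP[_ /andP[]]. Qed.
Let szc : 2 < size c. Proof. by case/andP: oc => /andP[]. Qed.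

(** On the even paths [theta_color] alternates, so the monochromatic edge of the cycle lies on path
    0. *)
Lemma odd_cycle_ends : ends \in D.
Proof.
have [v vc vE] := odd_cycle_monochromatic theta_color oc.
have /theta_relP[i [a h]] := next_cycle cc vc.
have Enext : theta_edge i [set v; next c v].
  case: h => -[h1 h2]; first by exists v, (next c v), a.
  by exists (next c v), v, a; rewrite setUC.
have [i0|i0] := posnP i; first by rewrite -(theta_edge0 i0 Enext) cedges_next.
by case: h vE => -[/(theta_color_pos i0)-> /(theta_color_pos i0)->] /=; case: odd.
Qed.

Lemma cycle_edge E : E \in D -> exists i, theta_edge i E.
Proof.
case/imsetP=> v vc ->; have /theta_relP[i [a h]] := next_cycle cc vc.
exists i; case: h => -[h1 h2]; first by exists v, (next c v), a.
by exists (next c v), v, a; rewrite setUC.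
Qed.

(** An inner vertex has neighbours only at the two adjacent positions, and its predecessor and
    successor on the cycle are distinct, so they occupy both. *)
Lemma internal_neighbors v i a : v \in c -> pos v i = Some a.+1 -> a.+1 < nth 0 P i ->
  exists n1 n2, [/\ pos n1 i = Some a, pos n2 i = Some a.+2,
    [set v; n1] \in D & [set v; n2] \in D].
Proof.
move=> vc pv aP.
have nbr w : theta_rel P v w -> pos w i = Some a \/ pos w i = Some a.+2.
  case/theta_relP=> k [b h].
  have ki : k = i.
    by case: h => -[h1 h2]; [exact: theta_pos_unique_path pv _ h1 | exact: theta_pos_unique_path pv _ h2].
  by subst k; case: h => -[h1 h2]; [right; move: h1 h2 | left; move: h2 h1];
    rewrite pv => -[<-].
have nn := next_neq_prev szc Uc vc.
have en := cedges_next vc; have ep := cedges_prev Uc vc.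
have [hn|hn] := nbr _ (next_cycle cc vc);
  have [hp|hp] := nbr _ (cycle_edge_prev theta_rel_sym cc vc).
- by rewrite (theta_pos_inj hn hp) eqxx in nn.
- by exists (next c v), (prev c v).
- by exists (prev c v), (next c v).
- by rewrite (theta_pos_inj hn hp) eqxx in nn.
Qed.

(** From one inner vertex on the cycle, [internal_neighbors] allows a descent to position 1 and then
    an ascent through all inner positions. *)
Lemma path_covered i v a : v \in c -> pos v i = Some a -> 0 < a < nth 0 P i ->
  forall E, theta_edge i E -> E \in D.
Proof.
move=> vc pv /andP[a0 aP].
have inc w z : [set w; z] \in D -> z \in c by move=> wz; apply: (cedges_mem wz); rewrite set22.
have [w wc pw] : exists2 w, w \in c & pos w i = Some 1.
  elim: a v vc pv a0 aP => // -[|a] IHa v vc pv _ aP; first by exists v.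
  have [n1 [_ [p1 _ /inc n1c _]]] := internal_neighbors vc pv aP.
  by apply: (IHa n1) => //; apply: ltnW.
have up b : 0 < b < nth 0 P i -> exists2 u, u \in c & pos u i = Some b.
  elim: b => // -[|b] IHb /andP[_ bP]; first by exists w.
  have [u uc pu] := IHb (ltnW bP).
  have [_ [n2 [_ p2 _ /inc n2c]]] := internal_neighbors uc pu (ltnW bP).
  by exists n2.
move=> E [u [u' [b [-> pu pu']]]]; have bP := theta_pos_leq pu'.
(* The edge at position 0 is obtained from its upper end, any other edge from its lower end, so that
   this end is always inner. *)
case: b pu pu' bP => [|b] pu pu' bP.
  have P2 : 1 < nth 0 P i by apply: leq_ltn_trans aP.
  have [n1 [_ [p1 _ D1 _]]] := internal_neighbors wc pw P2.
  by rewrite setUC (theta_pos_inj pu p1) (theta_pos_inj pu' pw).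
have [t tc pt] := up b.+1 bP.
have [_ [n2 [_ p2 _ D2]]] := internal_neighbors tc pt bP.
by rewrite (theta_pos_inj pu pt) (theta_pos_inj pu' p2).
Qed.

(** A path other than path 0 has length at least 2, so each of its edges has an inner end, to which
    [path_covered] applies. The edge at [inl false] is singled out for counting neighbours there. *)
Lemma edge_path_covered i E : 0 < i -> theta_edge i E -> E \in D ->
  (forall F, theta_edge i F -> F \in D) /\ exists2 w, pos w i = Some 1 & [set inl false; w] \in D.
Proof.
move=> i0 [u [v [a [EE pu pv]]]] ED.
have uc : u \in c by apply: (cedges_mem ED); rewrite EE set21.
have vc : v \in c by apply: (cedges_mem ED); rewrite EE set22.
have aP := theta_pos_leq pv.
have P2 := P_gt1 i0.
have cov : forall F, theta_edge i F -> F \in D.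
  case: a pu pv aP => [|a] pu pv aP; first exact: path_covered vc pv _.
  exact: path_covered uc pu _.
split=> //.
have [w wE] : exists w, pos w i = Some 1.
  have jP : 0 < (nth 0 P i).-1 by rewrite -subn1 subn_gt0.
  by exists (inr (existT _ i (Ordinal jP))); rewrite /= eqxx.
by exists w => //; apply: cov; exists (inl false), w, 0.
Qed.

(** Otherwise [inl false] would have three distinct neighbours on the cycle: [inl true] and the
    first inner vertices of paths [i] and [k]. *)
Lemma odd_cycle_one_path i k E F : 0 < i -> 0 < k -> theta_edge i E -> theta_edge k F ->
  E \in D -> F \in D -> i = k.
Proof.
move=> i0 k0 Ei Fk ED FD.
have [_ [w pw wD]] := edge_path_covered i0 Ei ED.
have [_ [z pz zD]] := edge_path_covered k0 Fk FD.
have not_end b t (m : 'I_(size P)) : 0 < m -> pos t m = Some 1 -> inl b != t :> V.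
  move=> m0 pt; apply/eqP=> tE; move: pt; rewrite -tE; case: b {tE} => //= -[Pm1].
  by have := P_gt1 m0; rewrite /= Pm1.
have [wz|nwz] := eqVneq w z.
  by apply/esym; apply: (theta_pos_unique_path pw _ (_ : pos w k = Some 1)); rewrite ?P_gt1 // wz.
have x_ne : inl false != inl true :> V by [].
have := cedges_neighbor Uc wD (not_end _ _ _ i0 pw).
have := cedges_neighbor Uc zD (not_end _ _ _ k0 pz).
have := cedges_neighbor Uc odd_cycle_ends x_ne.
have xw := not_end true _ _ i0 pw; have xz := not_end true _ _ k0 pz.
by case=> E1 [] E2 [] E3; move: xw xz nwz; rewrite E1 E2 E3 ?eqxx.
Qed.

End OddCycle.

(** A shared edge other than [ends] lies on an even path, which both cycles then contain entirely;
    with [ends] it makes up each of them, so they coincide. *)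
Lemma theta_inGstar : inGstar (theta_rel P).
Proof.
move=> c1 c2 oc1 oc2 n12.
have only_ends E : E \in cedges c1 -> E \in cedges c2 -> E = ends.
  move=> E1 E2; have [i Ei] := cycle_edge oc1 E1.
  have [i0|i0] := posnP i; first exact: theta_edge0 i0 Ei.
  case/eqP: n12.
  have sub c c' : is_odd_cycle (theta_rel P) c -> is_odd_cycle (theta_rel P) c' ->
      E \in cedges c -> E \in cedges c' -> {subset cedges c <= cedges c'}.
    move=> oc oc' Ec Ec' F Fc; have [k Fk] := cycle_edge oc Fc.
    have [k0|k0] := posnP k; first by rewrite (theta_edge0 k0 Fk) odd_cycle_ends.
    have [cov _] := edge_path_covered oc' i0 Ei Ec'.
    by apply: cov; rewrite (odd_cycle_one_path oc i0 k0 Ei Fk Ec Fc).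
  by apply/setP=> F; apply/idP/idP; apply: sub.
apply/card_le1_eqP => E F /setIP[E1 E2] /setIP[F1 F2].
by rewrite (only_ends E) // (only_ends F).
Qed.

End ThetaGstar.

(** Both cycles are pulled back along the embedding [g]; as [g] is injective, taking images of edges
    commutes with intersection. *)
Lemma iso_on_odd_cycles (T : finType) (e : rel T) (B : {set T}) (U : finType) (eU : rel U) c1 c2 :
  iso_on e B U eU -> inGstar eU -> is_odd_cycle e c1 -> is_odd_cycle e c2 ->
  {subset c1 <= B} -> {subset c2 <= B} ->
  cedges c1 != cedges c2 -> #|cedges c1 :&: cedges c2| <= 1.
Proof.
move=> /iso_on_codom[g [g_inj gB ge]] eG.
have lift c : {subset c <= B} -> exists c', c = map g c'.
  elim: c => [|t c IHc] sub; first by exists [::].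
  have /codomP[u tE] : t \in codom g by rewrite gB sub ?mem_head.
  have [c' cE] : exists c', c = map g c' by apply: IHc => z zc; apply: sub; rewrite inE zc orbT.
  by exists (u :: c'); rewrite tE cE.
have odd_map c : is_odd_cycle e (map g c) = is_odd_cycle eU c.
  rewrite /is_odd_cycle /is_cycle /ucycleb size_map map_inj_uniq // cycle_map.
  by rewrite (eq_cycle (e' := eU)).
have cedges_map c : uniq c -> cedges (map g c) = [set g @: (E : {set U}) | E in cedges c].
  move=> Uc; apply/setP=> E; apply/imsetP/imsetP => [[t /mapP[u uc ->] ->]|[E' /imsetP[u uc ->] ->]].
    exists [set u; next c u]; first exact: cedges_next.
    by rewrite imsetU1 imset_set1 next_map.
  exists (g u); first exact: map_f.
  by rewrite imsetU1 imset_set1 next_map.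
move=> oc1 oc2 /lift[d1 E1] /lift[d2 E2]; subst c1 c2.
move: oc1 oc2; rewrite !odd_map => oc1 oc2.
have Uod c : is_odd_cycle eU c -> uniq c by case/andP=> /andP[_ /andP[]].
rewrite !cedges_map ?Uod // => n12; rewrite -imsetI; last by move=> ? ? _ _; apply: imset_inj.
apply: leq_trans (leq_imset_card _ _) _; apply: eG => //.
by apply: contraNneq n12 => ->.
Qed.

Lemma path_index_edge (T : eqType) (e : rel T) x s p q : path e x s ->
  p \in x :: s -> q \in x :: s -> (index p (x :: s)).+1 == index q (x :: s) -> e p q.
Proof.
move=> /(pathP x) es pF qF /eqP pq.
have lt_p : index p (x :: s) < size s by rewrite -ltnS pq index_mem.
have := es _ lt_p; rewrite nth_index //.
by rewrite -[nth x s _]/(nth x (x :: s) _.+1) pq nth_index.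
Qed.

Lemma fan_iso_theta (T : finType) (e : rel T) (B : {set T}) x y ps :
  symmetric e -> is_fan e B x y ps -> B =i x :: y :: flatten ps ->
  {in B &, forall p q, e p q -> fan_edge x y ps p q} ->
  iso_on e B (theta_vertex (1 :: map (fun s => (size s).+1) ps))
             (theta_rel (1 :: map (fun s => (size s).+1) ps)).
Proof.
move=> e_sym [exy _ aps U _] BE fanE.
(* The base edge enters as the path [[::]], which accounts for the leading 1. *)
apply: (@theta_of_paths T e B x y ([::] :: ps)) => // p q pB qB.
apply/idP/idP => [|/hasP[s sL /and3P[pF qF]]]; first exact: fanE.
have ps_s : path e x (rcons s y).
  move: sL; rewrite inE => /orP[/eqP->|/(allP aps)/andP[] //].
  by rewrite /= exy.
by case/orP; [exact: path_index_edge | rewrite e_sym; exact: path_index_edge].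
Qed.

Theorem mainTheorem1 (T : finType) (e : rel T)
    (e_sym : symmetric e) (e_irr : irreflexive e) :
  inGstar e <->
  (forall B : {set T}, is_block e B ->
     [\/ bipartite_on e B,
         K4_on e B
       | exists ps : seq nat,
           0 < size ps /\ all (fun p => (0 < p) && ~~ odd p) ps /\
           iso_on e B (theta_vertex (1 :: ps)) (theta_rel (1 :: ps))]).
Proof.
split=> [eG B [B2 _]|blocks c1 c2 oc1 oc2 n12].
  have [bip|[c oc cB]] : bipartite_on e B \/ exists2 c, is_odd_cycle e c & {subset c <= B}.
  - by apply: bipartite_or_odd_cycle => //; case: B2 => _ [].
  - by constructor 1.
  have [x0 [y0 [s fan0]]] := odd_cycle_fan e_sym oc cB.
  have [K4|[x [y [ps [fan BE fanE]]]]] := fan_exhausts e_sym e_irr eG B2 fan0.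
    by constructor 2.
  constructor 3; exists (map (fun s => (size s).+1) ps); rewrite size_map.
  have [_ ps0 aps _ _] := fan; split; first by rewrite lt0n size_eq0.
  split; last exact: fan_iso_theta fanE.
  by rewrite all_map; apply: sub_all aps => t /andP[ot _] /=; rewrite negbK.
(* Assuming two shared edges is what places both cycles in one block, where the hypothesis on blocks
   refutes it. *)
rewrite leqNgt; apply/negP => gt1.
have [B [Bb s1 s2]] := odd_cycles_in_block e_sym e_irr oc1 oc2 gt1.
suff le1 : #|cedges c1 :&: cedges c2| <= 1 by rewrite leqNgt gt1 in le1.
case: (blocks B Bb) => [bip|K4|[ps [_ [even_ps iso]]]].
- by case: (odd_cycle_not_bipartite oc1 s1 bip).
- exact: (K4_odd_cycles e_irr K4).
- exact: (iso_on_odd_cycles iso (theta_inGstar even_ps)).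
Qed.
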